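(* Let $f:P\times X\to Y$ be $K$-closed and $K$-convex. Let $T$ be an arbitrary (possibly infinite) index set, let $g_t:P\times X\to\overline{\mathbb R}$ be a convex function for each $t\in T$, and let $C:P\rightrightarrows X$ be a convex closed set-valued map given by $$C(p)=\{x\in X\mid g_t(p,x)\le 0,\ t\in T\}.$$ Let $(\bar p,\bar x)\in\mathrm{gph}\,\mathcal S$ and $\bar y=f(\bar p,\bar x)$. Let $H:P\rightrightarrows P\times X$ be defined by $H(p)=\{p\}\times C(p)$. Suppose that (i) $\mathbb{R}^+(\mathrm{rge}\,H-\mathrm{dom}\,f)$ is a closed subspace of $P\times X$; (ii) $\mathbb{R}^+(P-\mathrm{dom}\,C)$ is a closed subspace of $P$; that $C$ satisfies the basic constraint qualification (BCQ) at $(\bar p,\bar x)$, and that $F$ is $K$-dominated by $\mathcal F$ near $\bar p$. Then, for every $y^*\in Y^*$, $$\widehat D^*(\mathcal F+K)(\bar p,\bar y)(y^* )=\bigcup_{(p^*,x^* )\in D^*(f+K)(\bar p,\bar x)(y^* )}\Big\{p^*+u^*\ \Big|\ (u^*,-x^* )\in\bigcup_{\lambda\in A(\bar p,\bar x)}\sum_{t\in T}\lambda_t\partial g_t(\bar p,\bar x)\Big\}.$$ In particular, if $f$ is continuously differentiable at $(\bar p,\bar x)$, then for every $y^*\in K^*$, $$\widehat D^*(\mathcal F+K)(\bar p,\bar y)(y^* )=\Big\{\nabla_pf(\bar p,\bar x)^*(y^* )+u^*\ \Big|\ (u^*,-\nabla_xf(\bar p,\bar x)^*(y^* ))\in\bigcup_{\lambda\in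 A(\bar p,\bar x)}\sum_{t\in T}\lambda_t\partial g_t(\bar p,\bar x)\Big\}.$$
   Context: $X,Y,P$ are Banach spaces with duals $X^*,Y^*,P^*$; products carry the norm $\|(x,y)\|=\|x\|+\|y\|$. $K\subseteq Y$ is a pointed, closed, convex cone with apex at the origin, and $K^*=\{y^*\in Y^*\mid \langle y^*,k\rangle\ge 0\ \forall k\in K\}$. For a set $\Omega$, $\mathbb{R}^+(\Omega)=\mathrm{cone}\,\Omega=\{\lambda a\mid \lambda\ge 0,\ a\in\Omega\}$. $\overline{\mathbb R}=\mathbb R\cup\{\pm\infty\}$. For a set-valued map $G:U\rightrightarrows V$ between Banach spaces: $\mathrm{dom}\,G=\{u\mid G(u)\ne\emptyset\}$, $\mathrm{gph}\,G=\{(u,v)\mid v\in G(u)\}$, $\mathrm{rge}\,G=\bigcup_{u\in U}G(u)$. $G$ is convex (closed) if $\mathrm{gph}\,G$ is convex (closed). If $V=Y$, $\mathrm{epi}\,G=\{(u,y)\mid y\in G(u)+K\}$, $G$ is $K$-convex ($K$-closed) if $\mathrm{epi}\,G$ is convex (closed), and the profile map is $(G+K)(u)=G(u)+K$, so that $\mathrm{gph}(G+K)=\mathrm{epi}\,G$. All set-valued maps are assumed proper (nonempty domain). A single-valued map is regarded as the set-valued map with singleton values. For a convex set-valued map $G$ and $(\bar u,\bar v)\in\mathrm{gph}\,G$, the coderivative is $D^*G(\bar u,\bar v)(v^* )=\{u^*\in U^*\mid (u^*,-v^* )\in N((\bar u,\bar v),\mathrm{gph}\,G)\}$ for $v^*\in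 V^*$, where for a convex set $\Omega$ and $\bar w\in\Omega$, $N(\bar w,\Omega)=\{w^*\mid \langle w^*,w-\bar w\rangle\le 0\ \forall w\in\Omega\}$. $D^*(f+K)(\bar p,\bar x)$ denotes the coderivative of $f+K$ at the point $((\bar p,\bar x),f(\bar p,\bar x))$. For an arbitrary (possibly nonconvex) $G$ and $(\bar u,\bar v)\in\mathrm{gph}\,G$, the Fréchet coderivative is $\widehat D^*G(\bar u,\bar v)(v^* )=\{u^*\in U^*\mid (u^*,-v^* )\in\widehat N((\bar u,\bar v),\mathrm{gph}\,G)\}$, where for a set $\Omega$ and $\bar w\in\Omega$, $\widehat N(\bar w,\Omega)=\{w^*\mid \limsup_{w\to\bar w,\,w\in\Omega}\frac{\langle w^*,w-\bar w\rangle}{\|w-\bar w\|}\le 0\}$. $\partial$ is the subdifferential of convex analysis. $\nabla_pf(\bar p,\bar x)^*$ and $\nabla_xf(\bar p,\bar x)^*$ are the adjoints of the partial derivatives. $F:P\rightrightarrows Y$ is the objective map $F(p)=\{y\in Y\mid \exists x\in C(p),\ y=f(p,x)\}$. For nonempty $A\subseteq Y$, $\mathrm{Min}_KA=\{a\in A\mid (A-a)\cap(-K\setminus\{0\})=\emptyset\}$. $\mathcal F(p)=\mathrm{Min}_KF(p)$ is the perturbation map (with $\mathcal F(p)=\emptyset$ if $F(p)=\emptyset$) and $\mathcal S(p)=\{x\in C(p)\mid f(p,x)\in\mathcal F(p)\}$ is the solution map. $F$ is $K$-dominated by $\mathcal F$ near $\bar p$ if $F(p)\subseteq\mathcal F(p)+K$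 for all $p$ in some neighborhood of $\bar p$. $\mathbb R^{|T|}_+$ is the set of functions $\lambda:T\to\mathbb R$ taking positive values $\lambda_t$ at only finitely many points of $T$ and equal to zero at the other points. $A(\bar p,\bar x)=\{\lambda\in\mathbb R^{|T|}_+\mid \lambda_tg_t(\bar p,\bar x)=0,\ t\in T\}$ is the set of active constraint multipliers. Sums $\sum_{t\in T}\lambda_t\partial g_t(\bar p,\bar x)$ are Minkowski sums over the finitely many $t$ with $\lambda_t>0$ (equal to $\{0\}$ if there are none). $C$ satisfies (BCQ) at $(\bar p,\bar x)\in\mathrm{gph}\,C$ if $N((\bar p,\bar x),\mathrm{gph}\,C)\subset\bigcup_{\lambda\in A(\bar p,\bar x)}\big[\sum_{t\in T}\lambda_t\partial g_t(\bar p,\bar x)\big]$. *)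

(* Defs.v *)
From HB Require Import structures.
From mathcomp Require Import all_boot all_order all_algebra.
From mathcomp Require Import all_classical all_reals all_analysis.

Set Implicit Arguments.
Unset Strict Implicit.
Unset Printing Implicit Defensive.

Import Order.TTheory GRing.Theory Num.Theory.
Import numFieldNormedType.Exports.

Local Open Scope classical_set_scope.
Local Open Scope ring_scope.

(* The library norms a product by the maximum of the norms of the components.
   This is equivalent to the sum norm, so it yields the same topology, dual,
   closed sets, (continuous) differentiability and Banach spaces.  The Frechet
   normal cone below is written with the sum norm. *)
Definition dual (R : realType) (W : normedModType R) : set (W -> R) :=
  [set u : W -> R | scalar u /\ continuous u].

(* (u, v) in U^* x V^* seen as an element of (U x V)^*.  Since the components
   of a pair are not determined by the pairing of arbitrary functions, users
   must require u \in U^* and v \in V^* separately. *)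
Definition pairing (R : realType) (U V : Type) (u : U -> R) (v : V -> R) :
  U * V -> R := fun w => u w.1 + v w.2.

Definition cone (R : realType) (W : lmodType R) (A : set W) : set W :=
  [set l *: a | l in [set l : R | 0 <= l] & a in A].

Definition set_diff (W : zmodType) (A B : set W) : set W :=
  [set a - b | a in A & b in B].

Definition set_sum (W : zmodType) (A B : set W) : set W :=
  [set a + b | a in A & b in B].

Definition set_opp (W : zmodType) (A : set W) : set W := [set - a | a in A].

Definition closed_subspace (R : realType) (W : normedModType R) (A : set W) :=
  [/\ closed A, A 0 &
      forall (a : R) (u v : W), A u -> A v -> A (a *: u + v)].

Definition pointed_closed_convex_cone (R : realType) (Y : normedModType R)
    (K : set Y) :=
  [/\ closed K, convex_set K, K 0,
      forall (l : R) k, 0 <= l -> K k -> K (l *: k) &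
      K `&` set_opp K = [set 0]].

Definition dual_cone (R : realType) (Y : normedModType R) (K : set Y) :
  set (Y -> R) := [set y' | dual y' /\ forall k, K k -> 0 <= y' k].

Definition dom (U V : Type) (G : U -> set V) : set U := [set u | G u !=set0].
Definition gph (U V : Type) (G : U -> set V) : set (U * V) :=
  [set w | G w.1 w.2].
Definition rge (U V : Type) (G : U -> set V) : set V :=
  \bigcup_(u in setT) G u.

Definition single (U V : Type) (h : U -> V) : U -> set V :=
  fun u => [set h u].

Definition profile (U : Type) (Y : zmodType) (G : U -> set Y) (K : set Y) :
  U -> set Y := fun u => set_sum (G u) K.

Definition epi (U : Type) (Y : zmodType) (G : U -> set Y) (K : set Y) :
  set (U * Y) := [set w | set_sum (G w.1) K w.2].

Definition convex_map (R : realType) (U V : lmodType R) (G : U -> set V) :=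
  convex_set (gph G).
Definition closed_map (U V : topologicalType) (G : U -> set V) :=
  closed (gph G).
Definition K_convex (R : realType) (U Y : lmodType R) (G : U -> set Y)
  (K : set Y) := convex_set (epi G K).
Definition K_closed (R : realType) (U Y : normedModType R) (G : U -> set Y)
  (K : set Y) := closed (epi G K).

Definition normal_cone (R : realType) (W : normedModType R) (w0 : W)
    (O : set W) : set (W -> R) :=
  [set w' : W -> R | dual w' /\ forall w, O w -> w' (w - w0) <= 0].

(* The limit superior is over w <> w0; at an isolated point it is -oo. *)
Definition frechet_normal_cone (R : realType) (U V : normedModType R)
    (w0 : U * V) (O : set (U * V)) : set (U * V -> R) :=
  [set w' : U * V -> R | dual w' /\
    (limf_esup
       (fun w : U * V => (w' (w - w0) / (`|w.1 - w0.1| + `|w.2 - w0.2|))%:E)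
       (within O w0^') <= 0)%E].

Definition coderivative (R : realType) (U V : normedModType R)
    (G : U -> set V) (u0 : U) (v0 : V) (v' : V -> R) : set (U -> R) :=
  [set u' : U -> R | dual u' /\ normal_cone (u0, v0) (gph G) (pairing u' (\- v'))].

Definition frechet_coderivative (R : realType) (U V : normedModType R)
    (G : U -> set V) (u0 : U) (v0 : V) (v' : V -> R) : set (U -> R) :=
  [set u' : U -> R | dual u' /\
            frechet_normal_cone (u0, v0) (gph G) (pairing u' (\- v'))].

(* For extended-real-valued functions convexity is convexity of the epigraph
   in W x R, which avoids +oo - oo. *)
Definition convex_efun (R : realType) (W : lmodType R) (g : W -> \bar R) :=
  convex_set ([set w | (g w.1 <= w.2%:E)%E] : set (W * R^o)).

Definition subdiff (R : realType) (W : normedModType R) (g : W -> \bar R)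
    (w0 : W) : set (W -> R) :=
  [set w' : W -> R | [/\ dual w', g w0 \is a fin_num &
                forall w, ((w' (w - w0))%:E <= g w - g w0)%E]].

Definition multipliers (R : realType) (T : Type) : set (T -> R) :=
  [set l | (forall t, 0 <= l t) /\ finite_set [set t | 0 < l t]].

(* The product follows the convention 0 * (-oo) = 0. *)
Definition active_multipliers (R : realType) (T W : Type)
    (g : T -> W -> \bar R) (w0 : W) : set (T -> R) :=
  [set l | multipliers l /\ forall t, ((l t)%:E * g t w0 = 0)%E].

(* Minkowski sum of the sets l_t * subdiff (g t) w0 over the t with l_t > 0. *)
Definition subdiff_sum (R : realType) (T : Type) (W : normedModType R)
    (g : T -> W -> \bar R) (w0 : W) (l : T -> R) : set (W -> R) :=
  [set w' | exists v : T -> W -> R,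
     (forall t, 0 < l t -> subdiff (g t) w0 (v t)) /\
     w' = (fun w =>
       \sum_(t \in [set t : {classic T} | 0 < l t]) l t * v t w)].

Definition active_subdiff (R : realType) (T : Type) (W : normedModType R)
    (g : T -> W -> \bar R) (w0 : W) : set (W -> R) :=
  \bigcup_(l in active_multipliers g w0) subdiff_sum g w0 l.

Definition constraint_map (R : realType) (T P X : Type)
    (g : T -> P * X -> \bar R) : P -> set X :=
  fun p => [set x | forall t, (g t (p, x) <= 0)%E].

Definition BCQ (R : realType) (T : Type) (P X : normedModType R)
    (g : T -> P * X -> \bar R) (p0 : P) (x0 : X) :=
  normal_cone (p0, x0) (gph (constraint_map g)) `<=` active_subdiff g (p0, x0).

Definition objective_map (P X Y : Type) (f : P * X -> Y) (C : P -> set X) :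
  P -> set Y := fun p => [set y | exists2 x, C p x & y = f (p, x)].

Definition Min (Y : zmodType) (K A : set Y) : set Y :=
  [set a | A a /\ set_diff A [set a] `&` (set_opp K `\ 0) = set0].

Definition perturbation_map (P X : Type) (Y : zmodType) (f : P * X -> Y)
    (C : P -> set X) (K : set Y) : P -> set Y :=
  fun p => Min K (objective_map f C p).

Definition solution_map (P X : Type) (Y : zmodType) (f : P * X -> Y)
    (C : P -> set X) (K : set Y) : P -> set X :=
  fun p => [set x | C p x /\ perturbation_map f C K p (f (p, x))].

Definition dominated_near (P : topologicalType) (Y : zmodType)
    (F G : P -> set Y) (K : set Y) (p0 : P) :=
  \forall p \near p0, F p `<=` set_sum (G p) K.

(* f is differentiable around w0 and its derivative is continuous at w0 for
   the operator norm. *)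
Definition continuously_differentiable_at (R : realType)
    (W Y : normedModType R) (f : W -> Y) (w0 : W) :=
  (\forall w \near w0, differentiable f w) /\
  (forall e : R, 0 < e -> \forall w \near w0,
     forall h, `|'d f w h - 'd f w0 h| <= e * `|h|).

Definition adjoint (R : realType) (U V : normedModType R) (L : U -> V)
  (v' : V -> R) : U -> R := v' \o L.

Definition partial_p (R : realType) (P X Y : normedModType R)
    (f : P * X -> Y) (p0 : P) (x0 : X) : P -> Y :=
  'd (fun p => f (p, x0)) p0.

Definition partial_x (R : realType) (P X Y : normedModType R)
    (f : P * X -> Y) (p0 : P) (x0 : X) : X -> Y :=
  'd (fun x => f (p0, x)) x0.

(* Main.v *)
Require Import Defs.
From HB Require Import structures.
From mathcomp Require Import all_boot all_order all_algebra.
From mathcomp Require Import all_classical all_reals all_analysis.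
From mathcomp Require Import ring lra.
Import Order.TTheory GRing.Theory Num.Theory.
Import numFieldNormedType.Exports.
Local Open Scope classical_set_scope.
Local Open Scope ring_scope.

(** The profile map of the perturbation map agrees, near the reference
    parameter, with that of the objective map, because the domination property
    gives F + K = calF + K there.  The graph of F + K is convex, so the Frechet
    normal cone is the normal cone of convex analysis
    ([frechet_coderivative_perturbation]), and the task becomes a coderivative
    chain rule for the convex map F + K.

    Testing normals in the directions of K shows that the coderivative at y' is
    empty unless y' is nonnegative on K; then phi = y' \o f is convex, and
    membership in a coderivative of a profile map is a subgradient inequality
    ([coderivative_profileP]).  For F + K it reads

      p'(p - pbar) <= phi(p, x) - phi(pbar, xbar)    on gph C,

    where gph C is convex.  The algebraic
    Hahn-Banach theorem inserts a linear functional l between the two sides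
    ([convex_sandwich]): l is a subgradient of phi at (pbar, xbar), that is, an
    element of the coderivative of f + K, and (p', 0) - l is normal to gph C.
    Splitting l = (q1, q2) gives p' = q1 + u' with (u', -q2) normal to gph C.
    By the constraint qualification that normal cone consists of the active
    sums of subgradients; the reverse inclusion is the sign of the active
    constraints ([active_subdiff_normal]).

    The analytic point is the continuity of l, for which it suffices that phi be
    bounded above near (pbar, xbar).  Closedness of the epigraph of f does not
    make phi lower semicontinuous, so the bound comes from the multimap
    w |-> f w + K: its graph is closed and convex and its domain is the whole
    space, so by Baire's theorem and the successive approximation argument of
    the open mapping theorem it has a locally bounded selection
    ([closed_convex_bounded_selection]).

    When f is differentiable, comparing directional derivatives shows that
    y' \o 'd f is the only subgradient of phi
    ([coderivative_differentiable]), and the union over the coderivative of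
    f + K reduces to one pair, given by the adjoint partial derivatives. *)

Set Implicit Arguments.
Unset Strict Implicit.
Unset Printing Implicit Defensive.

(** * Linear functionals and convexity *)

Lemma scalar_add (R : realType) (V : lmodType R) (u : V -> R) :
  scalar u -> {morph u : x y / x + y}.
Proof. by move=> lu x y; have := lu 1 x y; rewrite scale1r mul1r. Qed.

Lemma scalar_zero (R : realType) (V : lmodType R) (u : V -> R) :
  scalar u -> u 0 = 0.
Proof. by move=> /scalar_add /(_ 0 0); rewrite addr0; lra. Qed.

Lemma scalar_scale (R : realType) (V : lmodType R) (u : V -> R) :
  scalar u -> forall k x, u (k *: x) = k * u x.
Proof. by move=> lu k x; have := lu k x 0; rewrite !addr0 scalar_zero// addr0. Qed.

Lemma scalar_opp (R : realType) (V : lmodType R) (u : V -> R) :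
  scalar u -> {morph u : x / - x}.
Proof. by move=> lu x; rewrite -scaleN1r scalar_scale// mulN1r. Qed.

Lemma scalar_sub (R : realType) (V : lmodType R) (u : V -> R) :
  scalar u -> {morph u : x y / x - y}.
Proof. by move=> lu x y; rewrite scalar_add// scalar_opp. Qed.

Lemma convex_setP (R : realType) (V : lmodType R) (A : set V) :
  convex_set A <-> forall (l : R) x y, 0 <= l -> l <= 1 -> A x -> A y ->
    A (l *: x + (1 - l) *: y).
Proof.
split=> [cA l x y l0 l1 Ax Ay|cA x y l /set_mem Ax /set_mem Ay].
  have lP : Itv.spec (@Itv.num_sem R) (Itv.Real `[0%Z, 1%Z]) l.
    by rewrite /Itv.spec/= /Itv.num_sem/= in_itv/= l0 l1 ger0_real.
  exact: set_mem (cA x y (Itv.mk lP) (mem_set Ax) (mem_set Ay)).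
by apply/mem_set/cA => //; rewrite ?ge0 ?le1.
Qed.

Definition convex_fun (R : realType) (V : lmodType R) (phi : V -> R) :=
  forall (l : R) x y, 0 <= l -> l <= 1 ->
    phi (l *: x + (1 - l) *: y) <= l * phi x + (1 - l) * phi y.

(** * The Hahn-Banach theorem and the subdifferential sum rule *)

Definition sublinear (R : realType) (V : lmodType R) (q : V -> R) :=
  (forall x y, q (x + y) <= q x + q y) /\
  (forall t x, 0 < t -> q (t *: x) = t * q x).

Lemma sublinear0 (R : realType) (V : lmodType R) (q : V -> R) :
  sublinear q -> q 0 = 0.
Proof. by case=> _ /(_ 2 0 ltac:(lra)); rewrite scaler0; lra. Qed.

(** Three infima are shown to be sublinear this way.  The lower bound
    needed for the infimum at x comes from adding a value at - x, which gives a
    value at 0, hence a nonnegative one. *)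
Lemma sublinear_inf (R : realType) (V : lmodType R) (Phi : V -> set R) :
  (forall x, Phi x !=set0) -> (forall a, Phi 0 a -> 0 <= a) ->
  (forall x y a b, Phi x a -> Phi y b -> exists2 c, Phi (x + y) c & c <= a + b) ->
  (forall t x a, 0 < t -> Phi x a -> Phi (t *: x) (t * a)) ->
  sublinear (fun x => inf (Phi x)) /\ forall x a, Phi x a -> inf (Phi x) <= a.
Proof.
move=> Phi_ne Phi_ge0 PhiD PhiZ.
have infP x : has_inf (Phi x).
  split=> //; have [b Pb] := Phi_ne (- x); exists (- b) => a Pa.
  have [c] := PhiD _ _ _ _ Pa Pb; rewrite subrr => /Phi_ge0; lra.
have inf_le x a : Phi x a -> inf (Phi x) <= a.
  by move=> Pa; apply: ge_inf => //; case: (infP x).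
have infZ t x : 0 < t -> inf (Phi (t *: x)) <= t * inf (Phi x).
  move=> t0; rewrite -ler_pdivrMl//; apply: lb_le_inf => // a Pa.
  by rewrite ler_pdivrMl//; exact/inf_le/PhiZ.
split=> //; split=> [x y|t x t0].
  rewrite -lerBlDr; apply: lb_le_inf => // a Pa.
  rewrite lerBlDr -lerBlDl; apply: lb_le_inf => // b Pb.
  by have [c /inf_le] := PhiD _ _ _ _ Pa Pb; lra.
apply/eqP; rewrite eq_le infZ//=.
have := infZ t^-1 (t *: x); rewrite invr_gt0 scalerA mulVf ?gt_eqF// scale1r.
by move=> /(_ t0); rewrite -ler_pdivrMl ?invr_gt0// invrK.
Qed.

(** For fixed x, the infimum over t >= 0 of q (y + t x) - t q x is a sublinear
    function of y below q, hence equal to q by minimality; its value at - x is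
    at most q 0 - q x, which forces q (- x) = - q x.  An odd sublinear
    functional is linear. *)
Lemma minimal_sublinear_scalar (R : realType) (V : lmodType R) (q : V -> R) :
  sublinear q ->
  (forall r, sublinear r -> (forall x, r x <= q x) -> forall x, q x <= r x) ->
  scalar q.
Proof.
move=> sq qmin; have [qD qZ] := sq; have q0 := sublinear0 sq.
have qZ0 t x : 0 <= t -> q (t *: x) = t * q x.
  by rewrite le_eqVlt => /predU1P[<-|/qZ//]; rewrite scale0r mul0r.
have qN x : q (- x) = - q x.
  pose Phi y := [set q (y + t *: x) - t * q x | t in [set t : R | 0 <= t]].
  have [sr r_le] : sublinear (fun y => inf (Phi y)) /\
      forall y a, Phi y a -> inf (Phi y) <= a.
    apply: sublinear_inf => [y|_ [t/= t0 <-]|y z _ _ [t/= t0 <-] [s/= s0 <-]|].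
    - by exists (q (y + 0 *: x) - 0 * q x), 0 => /=.
    - by rewrite add0r qZ0// subrr.
    - exists (q (y + z + (t + s) *: x) - (t + s) * q x).
        by exists (t + s) => //=; rewrite addr_ge0.
      have := qD (y + t *: x) (z + s *: x).
      by rewrite addrACA -scalerDl; lra.
    - move=> t y _ t0 [s/= s0 <-]; exists (t * s) => /=.
        by rewrite mulr_ge0// ltW.
      by rewrite -scalerA -scalerDr qZ// mulrBr mulrA.
  have /(qmin _ sr)/(_ (- x)) q_le y : inf (Phi y) <= q y.
    by apply: r_le; exists 0 => //=; rewrite scale0r addr0 mul0r subr0.
  have : Phi (- x) (q (- x + 1 *: x) - 1 * q x) by exists 1 => /=.
  rewrite scale1r addNr q0 => /r_le; have := qD x (- x); rewrite subrr q0; lra.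
have qadd x y : q (x + y) = q x + q y.
  have := qD x y; have := qD (x + y) (- y); rewrite addrK qN; lra.
move=> a x y; rewrite qadd; congr (_ + _).
have [/qZ0//|a0] := leP 0 a.
by rewrite -[a]opprK scaleNr qN qZ0 ?mulNr// oppr_ge0 ltW.
Qed.

(** Zorn's lemma is applied to the sublinear functionals below p, ordered
    downwards, instead of to partial linear extensions: a minimal one is already
    linear. *)
Lemma hahn_banach (R : realType) (V : lmodType R) (p : V -> R) :
  sublinear p -> exists2 l : V -> R, scalar l & forall x, l x <= p x.
Proof.
move=> sp; pose S (q : V -> R) := sublinear q /\ forall x, q x <= p x.
pose T := {q : V -> R | S q}.
pose le (a b : T) := `[< forall x, sval b x <= sval a x >].
have t0 : T by exists p.
have [|a b c /asboolP ab /asboolP bc|A totA|[q [sq qp]] qmax] :=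
  @ZL_preorder T t0 le.
- by move=> t; apply/asboolP.
- by apply/asboolP => x; exact: le_trans (bc x) (ab x).
- have [[a0 Aa0]|A0] := pselect (A !=set0); last first.
    by exists t0 => a Aa; exfalso; apply: A0; exists a.
  pose Phi x := [set sval a x | a in A].
  have [sr r_le] : sublinear (fun x => inf (Phi x)) /\
      forall x a, Phi x a -> inf (Phi x) <= a.
    apply: sublinear_inf => [x|_ [a Aa <-]|x y _ _ [a Aa <-] [b Ab <-]|].
    - by exists (sval a0 x), a0.
    - by rewrite (sublinear0 (svalP a).1).
    - have [/asboolP ab|/asboolP ba] := totA _ _ Aa Ab.
      + exists (sval b (x + y)); first by exists b.
        by apply: le_trans ((svalP b).1.1 x y) _; rewrite lerD2r.
      + exists (sval a (x + y)); first by exists a.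
        by apply: le_trans ((svalP a).1.1 x y) _; rewrite lerD2l.
    - move=> t x _ t_gt0 [a Aa <-]; exists a => //.
      exact: (svalP a).1.2.
  have rp x : inf (Phi x) <= p x.
    by apply: le_trans ((svalP a0).2 x); apply: r_le; exists a0.
  exists (exist S _ (conj sr rp)) => a Aa; apply/asboolP => x /=.
  by apply: r_le; exists a.
exists q => //; apply: minimal_sublinear_scalar => // r sr rq.
have rp x : r x <= p x by exact: le_trans (rq x) (qp x).
by have /asboolP := qmax (exist S r (conj sr rp)) (asboolT rq).
Qed.

Lemma convex_combination_scale (R : realType) (V : lmodType R) (t s : R)
    (x y : V) : 0 < t -> 0 < s ->
  (t + s) *: ((t / (t + s)) *: x + (1 - t / (t + s)) *: y) = t *: x + s *: y.
Proof.
move=> t0 s0; have ts0 : t + s != 0 by rewrite gt_eqF// addr_gt0.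
rewrite scalerDr !scalerA; congr (_ *: _ + _ *: _); field; lra.
Qed.

(** The functional h |-> inf t (phi w - phi w0 - a (c - w0)), over all
    decompositions h = t (w - c) with t > 0 and c in A, is sublinear.  For a
    linear l below it, the decompositions with c = w0 make l a subgradient of
    phi at w0, and those with w = w0 make a - l normal to A. *)
Lemma convex_sandwich (R : realType) (V : lmodType R) (phi a : V -> R)
    (A : set V) (w0 : V) :
  convex_fun phi -> scalar a -> convex_set A -> A w0 ->
  (forall c, A c -> a (c - w0) <= phi c - phi w0) ->
  exists2 l : V -> R, scalar l &
    (forall w, l (w - w0) <= phi w - phi w0) /\
    (forall c, A c -> a (c - w0) <= l (c - w0)).
Proof.
move=> cphi la /convex_setP cA Aw0 aphi.
pose Phi h := [set r | exists t w c, [/\ 0 < t, A c, h = t *: (w - c) &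
  r = t * (phi w - phi w0 - a (c - w0))]].
have [sp p_le] : sublinear (fun y => inf (Phi y)) /\
    forall y r, Phi y r -> inf (Phi y) <= r.
  apply: sublinear_inf => [h|_ [t [w [c [t0 Ac + ->]]]]||].
  - exists (1 * (phi (w0 + h) - phi w0 - a (w0 - w0))), 1, (w0 + h), w0.
    by split=> //; rewrite scale1r addrC addKr.
  - move/esym/eqP; rewrite scaler_eq0 gt_eqF//= subr_eq0 => /eqP ->.
    by rewrite mulr_ge0 ?(ltW t0)// subr_ge0 aphi.
  - move=> h k _ _ [t [w [c [t0 Ac -> ->]]]] [s [z [d [s0 Ad -> ->]]]].
    pose l := t / (t + s).
    have ts0 : 0 < t + s by rewrite addr_gt0.
    have l0 : 0 <= l by rewrite divr_ge0 ?ltW.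
    have l1 : l <= 1 by rewrite ler_pdivrMr// mul1r; lra.
    exists ((t + s) * (phi (l *: w + (1 - l) *: z) - phi w0
       - a (l *: c + (1 - l) *: d - w0))).
      exists (t + s), (l *: w + (1 - l) *: z), (l *: c + (1 - l) *: d).
      split=> //; first exact: cA.
      by rewrite !scalerBr !convex_combination_scale// opprD addrACA.
    have tE : (t + s) * l = t by rewrite mulrC divfK// gt_eqF.
    have sE : (t + s) * (1 - l) = s by rewrite mulrBr tE; lra.
    clearbody l.
    have phi_le : (t + s) * phi (l *: w + (1 - l) *: z) <= t * phi w + s * phi z.
      have -> : t * phi w + s * phi z = (t + s) * (l * phi w + (1 - l) * phi z).
        by rewrite mulrDr !mulrA tE sE.
      by rewrite ler_pM2l// cphi.
    have a_eq : (t + s) * a (l *: c + (1 - l) *: d) = t * a c + s * a d.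
      by rewrite (scalar_add la) !(scalar_scale la) mulrDr !mulrA tE sE.
    by rewrite !(scalar_sub la); lra.
  - move=> t h _ t0 [s [w [c [s0 Ac -> ->]]]]; exists (t * s), w, c.
    by rewrite mulr_gt0// scalerA mulrA.
have [l ll lp] := hahn_banach sp.
exists l => //; split=> [w|c Ac].
  apply: le_trans (lp _) _; apply: p_le; exists 1, w, w0; split=> //.
    by rewrite scale1r.
  by rewrite subrr (scalar_zero la) mul1r subr0.
rewrite -[c - w0]opprB (scalar_opp ll) -[_ - c]opprB opprK lerNr opprB -[- a _]add0r.
apply: le_trans (lp _) _; apply: p_le; exists 1, w0, c; split=> //.
  by rewrite scale1r.
by rewrite mul1r subrr.
Qed.

(** * Open mapping *)

Lemma prod_complete (R : realType) (U V : completeNormedModType R)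
    (F : set_system ((U * V)%type : normedModType R)) :
  ProperFilter F -> cauchy F -> cvg F.
Proof.
move=> FF Fc.
have c1 : cauchy (fst @ F).
  move=> A entA; rewrite near_simpl -near2E near_map2.
  by apply: filterS (Fc _ (prod_entP entA entourageT)) => xy [].
have c2 : cauchy (snd @ F).
  move=> A entA; rewrite near_simpl -near2E near_map2.
  by apply: filterS (Fc _ (prod_entP entourageT entA)) => xy [].
apply/cvg_ex; exists (lim (fst @ F), lim (snd @ F)).
have l1 : cvg (fst @ F) by exact: cauchy_cvg.
have l2 : cvg (snd @ F) by exact: cauchy_cvg.
move=> A [B [/l1 B1 /l2 B2] BA].
have : F ((fst @^-1` B.1) `&` (snd @^-1` B.2)) by exact: filterI.
by apply: filterS => xy; exact: BA.
Qed.

(** An upper bound suffices: linearity turns it into a two-sided bound through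
    h |-> - h. *)
Lemma scalar_continuous (R : realType) (W : normedModType R) (l : W -> R)
    (w0 : W) (M : R) :
  scalar l -> (\forall w \near w0, l (w - w0) <= M) -> continuous l.
Proof.
move=> ll lM.
pose L : {linear W -> R^o} := HB.pack l (GRing.isLinear.Build R W R^o *:%R l ll).
have lN x : L (- x) = - L x by rewrite linearN.
suff : bounded_near L (nbhs 0) by move=> /bounded_linear_continuous.
move/nbhs_ballP : lM => [r /= r0 rM].
have {}rM h : `|h| < r -> L h <= M.
  move=> hr; have := rM (w0 + h); rewrite addrAC subrr add0r; apply.
  by rewrite -ball_normE/= opprD addrA subrr add0r normrN.
exists M; split; first by rewrite num_real.
move=> N MN; apply/nbhs_ballP; exists r => //= h.
rewrite -ball_normE/= sub0r normrN => hr; apply: le_trans (ltW MN).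
by rewrite ler_norml lerNl -lN !rM// normrN.
Qed.


(** Kept as a plain definition, so that no structure is attached globally to
    products. *)
Definition prod_completeNormedModType (R : realType)
    (U V : completeNormedModType R) : completeNormedModType R :=
  HB.pack (U * V)%type (Uniform_isComplete.Build
     ((U * V)%type : normedModType R) (@prod_complete R U V)).

(** The successive approximations of the open mapping theorem, in convex form:
    approximate points t_k of the ball by projections a_k of points of E,
    starting from t_0 = z + h and restarting from the doubled error
    t_(k+1) = z + 2 (t_k - a_k).  Then (t_0 + z) / 2 = z + h / 2 is the infinite
    convex combination of the a_k with weights 2^-(k+1); boundedness of E makes
    the same combination of the second components converge. *)
Lemma closed_convex_proj (R : realType) (W : normedModType R)
    (Y : completeNormedModType R) (E : set (W * Y)) (B r : R) (z : W) :
  closed E -> convex_set E -> (forall e, E e -> `|e.2| <= B) -> 0 < r ->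
  ball z r `<=` closure [set e.1 | e in E] ->
  forall h, `|h| < r -> exists y, E (z + 2^-1 *: h, y).
Proof.
move=> clE /convex_setP cE EB r0 zr h hr.
have /choice[step stepP] t : exists e, ball z r t -> E e /\ `|t - e.1| < r / 2.
  have [/zr|] := pselect (ball z r t); last by exists 0.
  have /[swap]/[apply] : nbhs t (ball t (r / 2)) by apply: nbhsx_ballx; lra.
  by case=> _ [[e Ee <-]]; rewrite -ball_normE/=; exists e.
pose t_ := fix t_ m := if m is k.+1 then z + 2 *: (t_ k - (step (t_ k)).1)
  else z + h.
have t_ball m : ball z r (t_ m).
  elim: m => [|m IHm]; rewrite -ball_normE/= opprD addrA subrr add0r normrN//.
  by rewrite normrZ gtr0_norm// mulrC -ltr_pdivlMr//; exact: (stepP _ IHm).2.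
pose e_ m := step (t_ m).
have Ee m : E (e_ m) by exact: (stepP _ (t_ball m)).1.
pose q m : R := 2^-1 ^+ m.
have qS m : q m.+1 = 2^-1 * q m by rewrite /q exprS.
have q_ge0 m : 0 <= q m by rewrite exprn_ge0.
have q_cvg0 : q @ \oo --> (0 : R).
  by apply: cvg_expr; rewrite ger0_norm//; lra.
have B0 : 0 <= B by apply: le_trans (EB _ (Ee 0%N)).
pose u m := q m.+1 *: (e_ m).2.
have u_cvg : cvgn (series u).
  apply: normed_cvg; apply: (@series_le_cvg _ _ (geometric (2^-1 * B) 2^-1)) => [m|m|m|].
  - exact: normr_ge0.
  - by rewrite /= mulr_ge0 ?mulr_ge0 ?exprn_ge0.
  - rewrite /= /u normrZ ger0_norm//.
    apply: le_trans (ler_wpM2l (q_ge0 _) (EB _ (Ee m))) _.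
    by rewrite qS /q mulrAC.
  - by apply: is_cvg_geometric_series; rewrite ger0_norm//; lra.
pose x_ m := z + 2^-1 *: h - q m.+1 *: (t_ m + z).
pose S m := (x_ m, series u m).
have half2 (x : W) : 2^-1 *: (x + x) = x.
  by rewrite -[x + x]mulr2n -[x *+ 2]scaler_nat scalerA mulVf// scale1r.
have S0 : S 0%N = 0.
  congr (_, _); last by rewrite /series/= big_geq.
  by rewrite /x_ /q expr1/= [z + h + z]addrAC scalerDr half2 subrr.
have SS m : S m.+1 = S m + q m.+1 *: e_ m.
  congr (_, _); last by rewrite /series/= big_nat_recr.
  rewrite /x_ -/t_ [t_ m.+1]/= -/(e_ m) qS mulrC -scalerA.
  rewrite [z + _ + z]addrAC scalerDr half2 scalerA mulVf// scale1r.
  have -> : z + (t_ m - (e_ m).1) = (t_ m + z) - (e_ m).1.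
    by rewrite addrA [z + _]addrC.
  by rewrite scalerBr opprD opprK addrA.
(* The partial combination S m has total weight 1 - q m; any point of E may
   carry the missing weight. *)
have ES m e : E e -> E (S m + q m *: e).
  elim: m e => [|m IHm] e Ee0; first by rewrite S0 add0r /q expr0 scale1r.
  rewrite SS -addrA -scalerDr qS mulrC -scalerA; apply: IHm.
  have -> : 2^-1 *: (e_ m + e) = 2^-1 *: e_ m + (1 - 2^-1) *: e.
    by rewrite scalerDr; congr (_ + _ *: _); lra.
  by apply: cE => //; lra.
have t_le m : `|t_ m + z| <= `|z| + r + `|z|.
  apply: le_trans (ler_normD _ _) _; rewrite lerD2r.
  rewrite -[t_ m](addrNK z) [_ - z + z]addrC.
  apply: le_trans (ler_normD _ _) _; rewrite lerD2l.
  by have := t_ball m; rewrite -ball_normE/= distrC => /ltW.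
have x_cvg : x_ @ \oo --> z + 2^-1 *: h.
  rewrite -[X in _ --> X]subr0; apply: cvgB; first exact: cvg_cst.
  apply/cvgr0Pnorm_lt => eps eps0.
  have M0 : 0 < `|z| + r + `|z| by rewrite ltr_wpDr// ltr_wpDl.
  have qM := cvgr0_norm_lt _ q_cvg0 _ (divr_gt0 eps0 M0).
  near=> m; rewrite normrZ.
  apply: le_lt_trans (ler_wpM2l (normr_ge0 _) (t_le m)) _.
  rewrite -ltr_pdivlMr// qS normrM ger0_norm//.
  have : `|q m| < eps / (`|z| + r + `|z|).
    by near: m; exact: qM.
  by have := normr_ge0 (q m); lra.
have S_cvg : (fun m => S m + q m *: e_ 0%N) @ \oo -->
    (z + 2^-1 *: h, lim (series u @ \oo)).
  rewrite -[X in _ --> X]addr0; apply: cvgD; first exact: cvg_pair.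
  rewrite -[X in _ --> X](scale0r (e_ 0%N)); exact: cvgZr_tmp.
exists (lim (series u @ \oo)); apply: (closed_cvg E clE _ _ S_cvg).
by apply: nearW => m; exact: ES.
Unshelve. all: by end_near. Qed.

(** By Baire's theorem the points having a value of norm at most n are dense in
    some ball, and the previous lemma removes the closure on a smaller ball.
    That ball is carried to w0 by averaging with the value at the point
    symmetric to its center with respect to w0. *)
Lemma closed_convex_bounded_selection (R : realType)
    (W Y : completeNormedModType R) (E : set (W * Y)) (w0 : W) :
  closed E -> convex_set E -> (forall w, exists y, E (w, y)) ->
  exists M, \forall w \near w0, exists2 y, E (w, y) & `|y| <= M.
Proof.
move=> clE /convex_setP cE domE.
pose E_ (n : nat) := E `&` [set e | `|e.2| <= n%:R].
have clE_ n : closed (E_ n).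
  apply: closedI => //; apply: (closed_comp _ (@closed_le _ n%:R)) => e _.
  by apply: continuous_comp; [exact: cvg_snd|exact: norm_continuous].
have cE_ n : convex_set (E_ n).
  apply/convex_setP => l x y l0 l1 [Ex xn] [Ey yn]; split; first exact: cE.
  rewrite /= in xn yn *; apply: le_trans (ler_normD _ _) _.
  rewrite !normrZ (ger0_norm l0) ger0_norm; last by lra.
  have -> : n%:R = l * n%:R + (1 - l) * n%:R :> R by ring.
  by rewrite lerD// ler_wpM2l//; lra.
have [n [z [r r0 zr]]] : exists n z, exists2 r, 0 < r &
    ball z r `<=` closure [set e.1 | e in E_ n].
  apply: contrapT => noball.
  pose F n := ~` closure [set e.1 | e in E_ n].
  have /Baire : forall n, open (F n) /\ dense (F n).
    move=> n; split; first by rewrite openC; exact: closed_closure.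
    move=> O [z Oz] oO; apply/set0P/negP => /eqP OF.
    have /nbhs_ballP[r /= r0 rO] : nbhs z O by exact: open_nbhs_nbhs.
    apply: noball; exists n, z, r => // w /rO Ow; apply: contrapT => Fw.
    by have : (O `&` F n) w by []; rewrite OF.
  move=> /(_ setT (ex_intro _ w0 I) openT)[w [_ Fw]].
  have [y Ewy] := domE w; apply: (Fw (Num.truncn `|y|).+1) => //.
  apply: subset_closure; exists (w, y) => //; split=> //=.
  by rewrite ltW// truncnS_gt.
have En_bnd e : E_ n e -> `|e.2| <= n%:R by case.
have zball := closed_convex_proj (clE_ n) (cE_ n) En_bnd r0 zr.
have [v Ev] := domE (w0 - (z - w0)).
exists (n%:R + `|v|); apply/nbhs_ballP.
(* w is the midpoint of z + 2^-1 *: (4 *: (w - w0)) and of the point symmetric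
   to z, and closed_convex_proj needs 4 *: (w - w0) of norm below r. *)
exists (r / 4) => /=; first by lra.
move=> w; rewrite -ball_normE/= => w0w.
have [|y [Ey yn]] := zball (4 *: (w - w0)).
  by rewrite normrZ gtr0_norm// -ltr_pdivlMl// mulrC distrC.
exists (2^-1 *: y + (1 - 2^-1) *: v); last first.
  apply: le_trans (ler_normD _ _) _; rewrite !normrZ ger0_norm; last by lra.
  rewrite ger0_norm; last by lra.
  rewrite /= in yn; have := normr_ge0 y; have := normr_ge0 v; lra.
have -> : w = 2^-1 *: (z + 2^-1 *: (4 *: (w - w0))) +
              (1 - 2^-1) *: (w0 - (z - w0)).
  have -> : 1 - 2^-1 = 2^-1 :> R by lra.
  have w02 : w0 + w0 = 2 *: w0 by rewrite scaler_nat mulr2n.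
  rewrite -scalerDr scalerA (_ : 2^-1 * 4 = 2); last by lra.
  rewrite opprB [z + _]addrC -addrA [z + _]addrC -[w0 + _ + z]addrA subrK w02.
  by rewrite -scalerDr subrK scalerA mulVf// scale1r.
have := cE 2^-1 _ _ _ _ Ey Ev; apply; lra.
Qed.

(** * Duality on products *)

Lemma dualD (R : realType) (W : normedModType R) (u v : W -> R) :
  dual u -> dual v -> dual (u \+ v).
Proof.
move=> [lu cu] [lv cv]; split=> [k x y|x].
  by rewrite /= lu lv; ring.
by apply: cvgD; [exact: cu|exact: cv].
Qed.

Lemma dualN (R : realType) (W : normedModType R) (u : W -> R) :
  dual u -> dual (\- u).
Proof.
move=> [lu cu]; split=> [k x y|x]; first by rewrite /= lu; ring.
by apply: cvgN; exact: cu.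
Qed.

Lemma dual_pairing (R : realType) (U V : normedModType R) (u : U -> R)
    (v : V -> R) : dual u -> dual v -> dual (pairing u v).
Proof.
move=> [lu cu] [lv cv]; split=> [k x y|x].
  by rewrite /pairing /= lu lv; ring.
apply: cvgD.
  by apply: (@continuous_comp _ _ _ fst u); [exact: cvg_fst|exact: cu].
by apply: (@continuous_comp _ _ _ snd v); [exact: cvg_snd|exact: cv].
Qed.

Lemma dual_pairE (R : realType) (U V : normedModType R) (l : U * V -> R) :
  dual l -> exists u v, [/\ dual u, dual v & l = pairing u v].
Proof.
move=> [ll cl]; exists (fun x => l (x, 0)), (fun y => l (0, y)); split.
- split=> [k x y|x]; first by rewrite -ll; congr l;
    apply: injective_projections; rewrite //= scaler0 addr0.
  apply: (@continuous_comp _ _ _ (fun x => (x, 0)) l); last exact: cl.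
  by apply: cvg_pair; [exact: cvg_id|exact: cvg_cst].
- split=> [k x y|x]; first by rewrite -ll; congr l;
    apply: injective_projections; rewrite //= scaler0 addr0.
  apply: (@continuous_comp _ _ _ (fun y => (0, y)) l); last exact: cl.
  by apply: cvg_pair; [exact: cvg_cst|exact: cvg_id].
- apply/funext => -[x y]; rewrite /pairing -scalar_add//=.
  by congr (l (_, _)); rewrite ?addr0 ?add0r.
Qed.

Lemma dual_bounded (R : realType) (W : normedModType R) (u : W -> R) :
  dual u -> exists c, forall x, u x <= c * `|x|.
Proof.
move=> [lu cu].
pose L : {linear W -> R^o} := HB.pack u (GRing.isLinear.Build R W R^o *:%R u lu).
have cL : continuous L by [].
have /linear_boundedP[c [_ Lc]] := continuous_linear_bounded 0 (cL 0).
exists (c + 1) => x; apply: le_trans (Lc (c + 1) _ x); last by lra.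
exact: ler_norm.
Qed.

(** * Normal cones *)

Lemma segment_cvg (R : realType) (W : normedModType R) (w d : W) :
  (fun t : R => w + t *: d) @ 0^'+ --> w.
Proof.
rewrite -[X in _ --> X]addr0 -[X in _ + X](scale0r d).
apply: cvgD; first exact: cvg_cst.
by apply: cvgZr_tmp; apply: cvg_at_right_filter; exact: cvg_id.
Qed.

(** Along the segment from w0 to a point w of the convex set the quotient in the
    limit superior is constant, so a limit condition at w0 already constrains
    w.  Conversely the quotient is nonpositive on the whole set. *)
Lemma frechet_normal_cone_convex (R : realType) (U V : normedModType R)
    (w0 : U * V) (O Q : set (U * V)) :
  convex_set Q -> Q w0 -> (\forall w \near w0, O w <-> Q w) ->
  frechet_normal_cone w0 O = normal_cone w0 Q.
Proof.
move=> /convex_setP cQ Qw0 OQ; apply/seteqP; split=> l [dl /= lO]; split=> //.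
  move=> w Qw; rewrite leNgt; apply/negP => l_gt0.
  have ww0 : w != w0.
    by apply: contraTneq l_gt0 => ->; rewrite subrr scalar_zero ?ltxx//; case: dl.
  pose n := `|w.1 - w0.1| + `|w.2 - w0.2|.
  have n_gt0 : 0 < n.
    rewrite lt_neqAle addr_ge0// andbT eq_sym paddr_eq0// !normr_eq0 !subr_eq0.
    by apply: contraNN ww0 => /andP[/eqP w1 /eqP w2]; apply/eqP/injective_projections.
  suff : ((l (w - w0) / n)%:E <= 0)%E by rewrite lee_fin leNgt divr_gt0.
  apply: le_trans lO; rewrite limf_esupE; apply: le_ereal_inf_tmp => _ [A OA <-].
  have OA' : \forall w \near w0, w != w0 -> O w -> A w by [].
  have [t [t_gt0 t_le1 [At ->]]] : exists t, [/\ 0 < t, t <= 1 &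
      A (w0 + t *: (w - w0)) /\ (l (w - w0) / n)%:E =
      (l (w0 + t *: (w - w0) - w0) /
       (`|(w0 + t *: (w - w0)).1 - w0.1| + `|(w0 + t *: (w - w0)).2 - w0.2|))%:E].
    near (0 : R)^'+ => t.
    have t_gt0 : 0 < t by near: t; exact: nbhs_right_gt.
    have t_le1 : t <= 1 by near: t; exact: nbhs_right_le.
    exists t; split=> //; split.
      have : O (w0 + t *: (w - w0)) <-> Q (w0 + t *: (w - w0)).
        by near: t; exact: (segment_cvg (w - w0) OQ).
      case=> _ QO; have : O (w0 + t *: (w - w0)).
        apply: QO; have := cQ t w w0 (ltW t_gt0) t_le1 Qw Qw0.
        by rewrite scalerBl scalerBr scale1r addrCA.
      have : w0 + t *: (w - w0) != w0.
        by rewrite -subr_eq0 addrAC subrr add0r scaler_eq0 gt_eqF//= subr_eq0.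
      by near: t; exact: (segment_cvg (w - w0) OA').
    rewrite addrAC subrr add0r /=.
    rewrite ![_ + t *: _ - _]addrAC !subrr !add0r !normrZ gtr0_norm//.
    rewrite -mulrDr scalar_scale; last by case: dl.
    by rewrite invfM mulrACA divff ?gt_eqF// mul1r.
  apply: ereal_sup_ubound.
  by exists (w0 + t *: (w - w0)).
have FOQ : within O w0^' (O `&` Q).
  rewrite /within/=; near=> w => Ow; split=> //.
  have : O w <-> Q w by near: w; exact: nbhs_dnbhs OQ.
  by case=> + _; apply.
rewrite limf_esupE; apply: ge_ereal_inf.
eexists; first by exists (O `&` Q) => //; reflexivity.
apply: ge_ereal_sup => _ [w [_ Qw] <-]; rewrite lee_fin.
by rewrite mulr_le0_ge0// ?invr_ge0 ?addr_ge0// lO.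
Unshelve. all: by end_near. Qed.

(** * Coderivatives of profile maps *)

Lemma cone_add (R : realType) (Y : normedModType R) (K : set Y) (x y : Y) :
  pointed_closed_convex_cone K -> K x -> K y -> K (x + y).
Proof.
move=> [_ /convex_setP cK _ KZ _] Kx Ky.
have half : 1 - 2^-1 = 2^-1 :> R by lra.
have : K (2 *: (2^-1 *: x + (1 - 2^-1) *: y)).
  by apply: KZ; [lra | apply: cK => //; lra].
by rewrite half -scalerDr scalerA divff// scale1r.
Qed.

Lemma profileP (U : Type) (Y : zmodType) (G : U -> set Y) (K : set Y) u y :
  profile G K u y <-> exists2 a, G u a & K (y - a).
Proof.
split=> [[a Ga [k Kk <-]]|[a Ga Ka]]; first by exists a => //; rewrite addrC addKr.
by exists a => //; exists (y - a) => //; rewrite addrC subrK.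
Qed.

Lemma profile_single (U : Type) (Y : zmodType) (f : U -> Y) (K : set Y) u y :
  profile (single f) K u y <-> K (y - f u).
Proof. by rewrite profileP; split=> [[a ->]|Ky]//; exists (f u). Qed.

(** The graph of the profile map is stable under adding elements of K to the
    second component, which forces the sign of y' on K; once y' has that sign,
    the inequality only needs testing on G itself. *)
Lemma coderivative_profileP (R : realType) (U Y : normedModType R)
    (G : U -> set Y) (K : set Y) (u0 : U) (v0 : Y) (q : U -> R) (y' : Y -> R) :
  pointed_closed_convex_cone K -> G u0 v0 -> dual q -> dual y' ->
  coderivative (profile G K) u0 v0 y' q <->
  dual_cone K y' /\ forall u v, G u v -> q (u - u0) <= y' v - y' v0.
Proof.
move=> [_ _ K0 KZ _] G0 dq dy; have [lq _] := dq; have [ly _] := dy.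
split=> [[_ [_ qn]]|[[_ Ky] qn]].
  split; first split=> // k Kk.
    have := qn (u0, v0 + k); rewrite /pairing/= subrr addrAC subrr add0r.
    rewrite (scalar_zero lq) add0r oppr_le0; apply; apply/profileP.
    by exists v0 => //; rewrite addrC addKr.
  move=> u v Guv; have := qn (u, v); rewrite /pairing/= (scalar_sub lq) (scalar_sub ly) subr_le0.
  apply; apply/profileP.
  by exists v => //; rewrite subrr.
split=> //; split; first by apply: dual_pairing => //; exact: dualN.
move=> [u y] /profileP[v Guv /Ky]; rewrite /pairing/= !(scalar_sub ly).
have := qn _ _ Guv; lra.
Qed.

Lemma convex_fun_comp (R : realType) (W Y : normedModType R) (K : set Y)
    (f : W -> Y) (y' : Y -> R) :
  pointed_closed_convex_cone K -> K_convex (single f) K -> dual_cone K y' ->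
  convex_fun (y' \o f).
Proof.
move=> [_ _ K0 _ _] /convex_setP cf [[ly _] Ky] l x y l0 l1.
have epif w : epi (single f) K (w, f w).
  by apply/profile_single; rewrite subrr.
have /profile_single/Ky := cf l _ _ l0 l1 (epif x) (epif y).
by rewrite /= (scalar_sub ly) (scalar_add ly) !(scalar_scale ly) subr_ge0.
Qed.

(** For y in f w + K one has y' (f w) <= y' y, so a locally bounded selection of
    f + K bounds y' \o f from above. *)
Lemma convex_fun_comp_bounded (R : realType) (P X Y : completeNormedModType R)
    (K : set Y) (f : P * X -> Y) (y' : Y -> R) (w0 : P * X) :
  K_closed (single f) K -> K_convex (single f) K -> K 0 -> dual_cone K y' ->
  exists M, \forall w \near w0, y' (f w) <= M.
Proof.
move=> clf cf K0 [dy Ky]; have [c yc] := dual_bounded dy.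
pose W := prod_completeNormedModType P X.
have [|M nearM] := @closed_convex_bounded_selection R W Y
    (epi (single f) K) w0 clf cf.
  by move=> w; exists (f w); apply/profile_single; rewrite subrr.
exists (`|c| * M); apply: filterS nearM => w [y /profile_single/Ky].
rewrite scalar_sub ?subr_ge0; last by case: dy.
move=> fy yM; apply: le_trans fy (le_trans (yc y) _).
apply: le_trans (ler_wpM2r (normr_ge0 y) (ler_norm c)) _.
exact: ler_wpM2l.
Qed.

(** This is the subdifferential sum rule for phi = y' \o f and the indicator of
    gph C: q is a subgradient of phi and (u', - q.2) a normal to gph C, whose
    sum is (p', 0).  The local bound on phi from above makes the separating
    functional continuous. *)
Lemma coderivative_objective_map (R : realType)
    (P X Y : completeNormedModType R) (K : set Y) (f : P * X -> Y)
    (C : P -> set X) (p0 : P) (x0 : X) (y' : Y -> R) :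
  pointed_closed_convex_cone K -> K_closed (single f) K ->
  K_convex (single f) K -> convex_map C -> C p0 x0 -> dual y' ->
  coderivative (profile (objective_map f C) K) p0 (f (p0, x0)) y' =
  \bigcup_(q in [set q : (P -> R) * (X -> R) |
      [/\ dual q.1, dual q.2 &
          coderivative (profile (single f) K) (p0, x0) (f (p0, x0)) y'
            (pairing q.1 q.2)]])
    [set q.1 \+ u' | u' in [set u' | dual u' /\
        normal_cone (p0, x0) (gph C) (pairing u' (\- q.2))]].
Proof.
move=> coneK clf cf cC C0 dy; have [_ _ K0 _ _] := coneK.
have F0 : objective_map f C p0 (f (p0, x0)) by exists x0.
apply/seteqP; split=> [p' p'cod|_ [[q1 q2] [/= dq1 dq2 qcod] [u' [du' [_ u'N]] <-]]].
  have dp' : dual p' by case: p'cod.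
  move: p'cod; rewrite coderivative_profileP// => -[Ky p'_le].
  have [lp' _] := dp'.
  pose a (w : P * X) := p' w.1.
  have la : scalar a by move=> k x y; rewrite /a lp'.
  have [|l ll [l_le l_ge]] := convex_sandwich (convex_fun_comp coneK cf Ky)
      la cC (C0 : gph C (p0, x0)).
    by move=> [p x] Cpx; apply: p'_le; exists x.
  have [M nearM] := convex_fun_comp_bounded (p0, x0) clf cf K0 Ky.
  have dl : dual l.
    split=> //; apply: (@scalar_continuous _ _ _ (p0, x0) (M - y' (f (p0, x0)))) => //.
    apply: filterS nearM => w wM; apply: le_trans (l_le w) _.
    by rewrite lerD2r.
  have [q1 [q2 [dq1 dq2 lE]]] := dual_pairE dl.
  exists (q1, q2); first split=> //=.
    rewrite -lE coderivative_profileP//; split=> // w _ ->; exact: l_le.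
  exists (p' \- q1); last by apply/funext => p /=; lra.
  have du : dual (p' \- q1) by exact: dualD (dualN _).
  split=> //; split; first by apply: dual_pairing => //; exact: dualN.
  move=> w /l_ge; rewrite lE /a /pairing/=; lra.
rewrite coderivative_profileP//; last exact: dualD.
move: qcod; rewrite coderivative_profileP//; last exact: dual_pairing.
move=> [Ky q_le]; split=> // p _ [x Cpx ->].
have := q_le (p, x) _ erefl; have := u'N (p, x) Cpx; rewrite /pairing/=; lra.
Qed.

(** * The perturbation map *)

(** Locally in the parameter the two profile maps have the same values:
    calF is contained in F, and F in calF + K, where K + K is contained in K. *)
Lemma frechet_coderivative_perturbation (R : realType)
    (P X Y : normedModType R) (K : set Y) (f : P * X -> Y)
    (C : P -> set X) (p0 : P) (x0 : X) (y' : Y -> R) :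
  pointed_closed_convex_cone K -> K_convex (single f) K -> convex_map C ->
  C p0 x0 ->
  dominated_near (objective_map f C) (perturbation_map f C K) K p0 ->
  frechet_coderivative (profile (perturbation_map f C K) K) p0 (f (p0, x0)) y' =
  coderivative (profile (objective_map f C) K) p0 (f (p0, x0)) y'.
Proof.
move=> coneK /convex_setP cf /convex_setP cC C0 dom.
have [_ _ K0 _ _] := coneK.
rewrite /frechet_coderivative (frechet_normal_cone_convex (Q :=
  gph (profile (objective_map f C) K)))//.
- apply/convex_setP => l [p1 y1] [p2 y2] l0 l1.
  move=> /profileP[_ [x1 Cx1 ->] Ky1] /profileP[_ [x2 Cx2 ->] Ky2].
  have e1 : epi (single f) K ((p1, x1), y1) by apply/profile_single.
  have e2 : epi (single f) K ((p2, x2), y2) by apply/profile_single.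
  have /profile_single Ky := cf l _ _ l0 l1 e1 e2.
  apply/profileP; eexists; last exact: Ky.
  exists (l *: x1 + (1 - l) *: x2) => //.
  exact: (cC l (p1, x1) (p2, x2) l0 l1 Cx1 Cx2).
- by apply/profileP; exists (f (p0, x0)); [exists x0 | rewrite subrr].
- have : \forall w \near (p0, f (p0, x0)), objective_map f C w.1 `<=`
      set_sum (perturbation_map f C K w.1) K by exact: cvg_fst dom.
  apply: filterS => -[p y] /= domp; split=> /profileP[a Fa Ka]; apply/profileP.
    by exists a => //; case: Fa.
  have /profileP[b Fb Kb] := domp a Fa; exists b => //.
  by rewrite -(subrK a y) -addrA; exact: cone_add.
Qed.

(** A positive multiplier forces the constraint to vanish at the reference
    point, so its subgradients are nonpositive in every feasible direction. *)
Lemma active_subdiff_normal (R : realType) (T : Type) (P X : normedModType R)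
    (g : T -> P * X -> \bar R) (p0 : P) (x0 : X) (w' : P * X -> R) :
  dual w' -> active_subdiff g (p0, x0) w' ->
  normal_cone (p0, x0) (gph (constraint_map g)) w'.
Proof.
move=> dw [l [[l0 finl] lg] [v [vsub w'E]]]; split=> // -[p x] Cpx.
rewrite w'E; apply: fsumr_le0 => // t lt.
rewrite pmulr_rle0//; have [_ _ /(_ (p, x))] := vsub t lt.
have /eqP := lg t; rewrite mule_eq0 eqe gt_eqF//= => /eqP ->.
by rewrite sube0 => vg; rewrite -lee_fin; apply: le_trans vg (Cpx t).
Qed.

(** * The differentiable case *)

Lemma cvg_directional_derivative (R : realType) (W Y : normedModType R)
    (f : W -> Y) (w0 d : W) (y' : Y -> R) :
  differentiable f w0 -> dual y' ->
  (fun t : R => t^-1 * (y' (f (w0 + t *: d)) - y' (f w0))) @ 0^'+ -->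
    y' ('d f w0 d).
Proof.
move=> df [ly cy].
have : (fun t : R => t^-1 *: (f (t *: d + w0) - f w0)) @ 0^' --> 'd f w0 d.
  by rewrite -deriveE//; exact: diff_derivable.
move=> /(cvg_comp _ _)/(_ (cy _)); set h := _ \o _.
have -> : (fun t : R => t^-1 * (y' (f (w0 + t *: d)) - y' (f w0))) = h.
  by apply/funext => t; rewrite /h/= (scalar_scale ly) (scalar_sub ly) [w0 + _]addrC.
move=> hcvg A /hcvg hA.
have {}hA : \forall t \near (0 : R), t != 0 -> A (h t) by exact: hA.
suff : \forall t \near (0 : R), 0 < t -> A (h t) by [].
by apply: filterS hA => t + t0; apply; rewrite gt_eqF.
Qed.

(** A subgradient of y' \o f is bounded above by the directional derivatives of
    y' \o f, which are linear in the direction, so the two coincide; conversely,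
    difference quotients of a convex function at most equal its increments. *)
Lemma coderivative_differentiable (R : realType) (W Y : normedModType R)
    (K : set Y) (f : W -> Y) (w0 : W) (q : W -> R) (y' : Y -> R) :
  pointed_closed_convex_cone K -> K_convex (single f) K ->
  differentiable f w0 -> dual q -> dual_cone K y' ->
  coderivative (profile (single f) K) w0 (f w0) y' q <-> q = y' \o 'd f w0.
Proof.
move=> coneK cf df dq Ky; have [dy _] := Ky; have [lq _] := dq.
have [ly _] := dy.
rewrite coderivative_profileP//; split=> [[_ q_le]|->].
  have qd d : q d <= y' ('d f w0 d).
    apply: (closed_cvg (fun r : R => q d <= r) (@closed_ge _ _) _ _
      (cvg_directional_derivative (d := d) df dy)).
    near=> t; have t0 : 0 < t by near: t; exact: nbhs_right_gt.
    rewrite /= ler_pdivlMl// -(scalar_scale lq).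
    by have := q_le (w0 + t *: d) _ erefl; rewrite addrAC subrr add0r.
  apply/funext => d; apply/eqP; rewrite eq_le qd/=.
  by have := qd (- d); rewrite linearN (scalar_opp lq) (scalar_opp ly) lerN2.
split=> // w _ ->; apply: (closed_cvg (fun r : R => r <= y' (f w) - y' (f w0)) (@closed_le _ _) _ _
  (cvg_directional_derivative (d := w - w0) df dy)).
near=> t; have t0 : 0 < t by near: t; exact: nbhs_right_gt.
have t1 : t <= 1 by near: t; exact: nbhs_right_le.
rewrite /= ler_pdivrMl//.
have cphi := convex_fun_comp coneK cf Ky.
have := cphi t w w0 (ltW t0) t1.
have -> : t *: w + (1 - t) *: w0 = w0 + t *: (w - w0).
  by rewrite scalerBl scalerBr scale1r addrCA.
rewrite /=; lra.
Unshelve. all: by end_near. Qed.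

Lemma partial_pE (R : realType) (P X Y : normedModType R) (f : P * X -> Y)
    (p0 : P) (x0 : X) (h : P) : differentiable f (p0, x0) ->
  partial_p f p0 x0 h = 'd f (p0, x0) (h, 0).
Proof.
move=> df.
have dpair : is_diff p0 (fun p => (p, x0)) (fun h => (h, 0)) :=
  is_diff_pair (is_diff_id p0) (is_diff_cst x0 p0).
have dcomp := is_diff_comp dpair (differentiableP df).
by rewrite /partial_p (@diff_val _ _ _ _ _ _ _ dcomp).
Qed.

Lemma partial_xE (R : realType) (P X Y : normedModType R) (f : P * X -> Y)
    (p0 : P) (x0 : X) (h : X) : differentiable f (p0, x0) ->
  partial_x f p0 x0 h = 'd f (p0, x0) (0, h).
Proof.
move=> df.
have dpair : is_diff x0 (fun x => (p0, x)) (fun h => (0, h)) :=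
  is_diff_pair (is_diff_cst p0 x0) (is_diff_id x0).
have dcomp := is_diff_comp dpair (differentiableP df).
by rewrite /partial_x (@diff_val _ _ _ _ _ _ _ dcomp).
Qed.

(** By the chain rule each partial derivative is 'd f composed with an embedding
    of one factor, so the adjoint partial derivatives are the restrictions of
    y' \o 'd f to the two factors; this singles out one pair in the union over
    the coderivative of f + K. *)
Lemma pairing_adjoint (R : realType) (P X Y : normedModType R)
    (f : P * X -> Y) (p0 : P) (x0 : X) (y' : Y -> R) :
  differentiable f (p0, x0) -> dual y' ->
  [/\ dual (adjoint (partial_p f p0 x0) y'),
      dual (adjoint (partial_x f p0 x0) y') &
      forall q1 q2, dual q1 -> dual q2 ->
        pairing q1 q2 = y' \o 'd f (p0, x0) <->
        q1 = adjoint (partial_p f p0 x0) y' /\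
        q2 = adjoint (partial_x f p0 x0) y'].
Proof.
move=> df [ly cy].
have dl : dual (y' \o 'd f (p0, x0)).
  split=> [k x y|x]; first by rewrite /= linearP ly.
  by apply: continuous_comp; [exact: diff_continuous|exact: cy].
have adjE q1 q2 : dual q1 -> dual q2 -> pairing q1 q2 = y' \o 'd f (p0, x0) ->
    q1 = adjoint (partial_p f p0 x0) y' /\ q2 = adjoint (partial_x f p0 x0) y'.
  move=> [lq1 _] [lq2 _] qE; split; apply/funext => h; rewrite /adjoint/=.
    by rewrite partial_pE// -[RHS](congr1 (@^~ (h, 0)) qE) /pairing/= scalar_zero// addr0.
  by rewrite partial_xE// -[RHS](congr1 (@^~ (0, h)) qE) /pairing/= scalar_zero// add0r.
have [u [v [du dv lE]]] := dual_pairE dl.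
have [uE vE] := adjE u v du dv (esym lE).
rewrite -uE -vE; split=> // q1 q2 dq1 dq2; rewrite lE; split=> [qE|[-> ->]//].
by rewrite uE vE; apply: adjE; rewrite // qE.
Qed.

(** * The formula for the Frechet coderivative *)

Theorem theorem6 (R : realType) (X Y P : completeNormedModType R)
  (K : set Y) (f : P * X -> Y) (T : Type) (g : T -> P * X -> \bar R)
  (pbar : P) (xbar : X) :
  let C := constraint_map g in
  let F := objective_map f C in
  let calF := perturbation_map f C K in
  let S := solution_map f C K in
  let H := (fun p => [set p] `*` C p) : P -> set (P * X) in
  let ybar := f (pbar, xbar) in
  pointed_closed_convex_cone K ->
  K_closed (single f) K ->
  K_convex (single f) K ->
  (forall t, convex_efun (g t)) ->
  convex_map C ->
  closed_map C ->
  gph S (pbar, xbar) ->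
  closed_subspace (cone (set_diff (rge H) (dom (single f)))) ->
  closed_subspace (cone (set_diff setT (dom C))) ->
  BCQ g pbar xbar ->
  dominated_near F calF K pbar ->
  (forall y' : Y -> R, dual y' ->
     frechet_coderivative (profile calF K) pbar ybar y' =
     \bigcup_(q in [set q : (P -> R) * (X -> R) |
         [/\ dual q.1, dual q.2 &
             coderivative (profile (single f) K) (pbar, xbar) ybar y'
               (pairing q.1 q.2)]])
       [set q.1 \+ u' | u' in [set u' | dual u' /\
           active_subdiff g (pbar, xbar) (pairing u' (\- q.2))]])
  /\
  (continuously_differentiable_at f (pbar, xbar) ->
   forall y' : Y -> R, dual_cone K y' ->
     frechet_coderivative (profile calF K) pbar ybar y' =
     [set adjoint (partial_p f pbar xbar) y' \+ u' |
        u' in [set u' | dual u' /\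
          active_subdiff g (pbar, xbar)
            (pairing u' (\- adjoint (partial_x f pbar xbar) y'))]]).
Proof.
move=> C F calF S H ybar coneK clf cf _ cC _ [/= C0 _] _ _ bcq dom.
have part1 y' : dual y' ->
    frechet_coderivative (profile calF K) pbar ybar y' =
    \bigcup_(q in [set q : (P -> R) * (X -> R) |
        [/\ dual q.1, dual q.2 &
            coderivative (profile (single f) K) (pbar, xbar) ybar y'
              (pairing q.1 q.2)]])
      [set q.1 \+ u' | u' in [set u' | dual u' /\
          active_subdiff g (pbar, xbar) (pairing u' (\- q.2))]].
  move=> dy; rewrite frechet_coderivative_perturbation//.
  rewrite coderivative_objective_map//.
  apply: eq_bigcupr => -[q1 q2] [_ /= dq2 _].
  congr (image _ _); apply/seteqP; split=> u' [du' u'N]; split=> //.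
    exact: bcq.
  by apply: active_subdiff_normal => //; apply: dual_pairing => //; exact: dualN.
split=> // -[/nbhs_singleton df _] y' Ky.
have [dy _] := Ky; rewrite part1//.
have [dp dx adjE] := pairing_adjoint df dy.
rewrite (_ : [set q | _] =
  [set (adjoint (partial_p f pbar xbar) y', adjoint (partial_x f pbar xbar) y')]).
  by rewrite bigcup_set1.
apply/seteqP; split=> [[q1 q2] /= [dq1 dq2]|_ /= ->].
  rewrite coderivative_differentiable//; last exact: dual_pairing.
  by move/(adjE _ _ dq1 dq2) => [-> ->].
split=> //; apply/coderivative_differentiable => //; first exact: dual_pairing.
exact/(adjE _ _ dp dx).
Qed.
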